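(* Let $X$ be a finite-dimensional real polygonal Banach space and let $Y$ be a strictly convex real normed linear space. Let $T \in L(X,Y)$ with $\|T\|=1$. Then $T$ is an extreme contraction if and only if $\operatorname{span}(M_T \cap E_X) = X$.
   Context: All spaces are real. For a normed space $Z$, $B_Z$ and $S_Z$ are the closed unit ball and unit sphere, and $E_Z$ is the set of all extreme points of $B_Z$. A finite-dimensional Banach space $X$ is called polygonal if $B_X$ has only finitely many extreme points (equivalently, $S_X$ is a polytope). $L(X,Y)$ is the space of all bounded linear operators from $X$ to $Y$ with the usual operator norm. An operator $T\in L(X,Y)$ is an extreme contraction if it is an extreme point of the unit ball $B_{L(X,Y)}$. For $T\in L(X,Y)$, the norm attainment set is $M_T=\{x\in S_X:\|Tx\|=\|T\|\}$. *)

(* Defs.v *)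
From HB Require Import structures.
From mathcomp Require Import all_boot all_order all_algebra.
From mathcomp Require Import all_classical all_reals all_analysis.

Set Implicit Arguments.
Unset Strict Implicit.
Unset Printing Implicit Defensive.

Import Order.TTheory GRing.Theory Num.Theory.
Import numFieldNormedType.Exports.

Local Open Scope classical_set_scope.
Local Open Scope ring_scope.

#[short(type="finDimBanachType")]
HB.structure Definition FinDimBanach (R : numFieldType) :=
  {X of CompleteNormedModule R X & Vector R X}.

Section geometry.
Context {R : numFieldType}.

Definition unit_ball (Z : normedModType R) : set Z := [set z | `|z| <= 1].
Arguments unit_ball : clear implicits.

Definition unit_sphere (Z : normedModType R) : set Z := [set z | `|z| = 1].
Arguments unit_sphere : clear implicits.

Definition extreme_points (V : lmodType R) (K : set V) : set V :=
  [set z | K z /\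
    forall (x y : V) (t : R), K x -> K y -> 0 < t < 1 ->
      z = (1 - t) *: x + t *: y -> x = z /\ y = z].

Definition polygonal (Z : normedModType R) :=
  finite_set (extreme_points (unit_ball Z)).

Definition strictly_convex (Z : normedModType R) :=
  unit_sphere Z `<=` extreme_points (unit_ball Z).

(* `span` only takes finite sequences; A is an arbitrary set. *)
Definition set_span (V : vectType R) (A : set V) : set V :=
  [set v | exists2 s : seq V, [set` s] `<=` A & v \in span s].

End geometry.

Arguments unit_ball {R} Z.
Arguments unit_sphere {R} Z.

Section bounded_operators.
Context {R : realType} (X Y : normedModType R).

Definition bounded_op_pred : {pred X -> Y} := fun f =>
  `[< linear f /\ exists M : R, forall x, `|f x| <= M * `|x| >].

Record bounded_op := BoundedOp {
  bounded_op_fun :> X -> Y;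
  bounded_op_prop : bounded_op_fun \in bounded_op_pred }.

HB.instance Definition _ := [isSub for bounded_op_fun].
HB.instance Definition _ := [Choice of bounded_op by <:].

Lemma bounded_op_submod_closed : submod_closed bounded_op_pred.
Proof.
split=> [|a f g /asboolP[lf [M fM]] /asboolP[lg [N gN]]]; apply/asboolP; split.
- by move=> b x y; rewrite [LHS]/= scaler0 addr0.
- by exists 0 => x; rewrite mul0r normr0.
- move=> b x y; rewrite !fctE lf lg !scalerDr !scalerA [a * b]mulrC.
  by rewrite addrACA.
- exists (`|a| * M + N) => x; rewrite !fctE mulrDl (le_trans (ler_normD _ _))//.
  by rewrite lerD// normrZ -mulrA ler_wpM2l.
Qed.

HB.instance Definition _ :=
  GRing.isSubmodClosed.Build R (X -> Y) bounded_op_pred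
    bounded_op_submod_closed.
HB.instance Definition _ := [SubChoice_isSubLmodule of bounded_op by <:].

Lemma bounded_op_linear (T : bounded_op) : linear T.
Proof. by have /asboolP[] := bounded_op_prop T. Qed.

HB.instance Definition _ (T : bounded_op) :=
  GRing.isLinear.Build R X Y *:%R T (@bounded_op_linear T).

Lemma bounded_opE (T S : bounded_op) : T =1 S -> T = S.
Proof. by move=> TS; apply/val_inj/funext. Qed.

(* The supremum is over the ball rather than the sphere so that it is taken
   over a nonempty set also when X = 0. *)
Definition op_norm (T : bounded_op) : R := sup [set `|T x| | x in unit_ball X].

Lemma op_norm_has_sup (T : bounded_op) :
  has_sup [set `|T x| | x in unit_ball X].
Proof.
split; first by exists `|T 0|, 0 => //; rewrite /unit_ball/= normr0.
have /asboolP[_ [M TM]] := bounded_op_prop T.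
exists `|M| => _ [x x1 <-]; rewrite (le_trans (TM x))//.
by rewrite (le_trans (ler_norm _))// normrM normr_id ler_piMr.
Qed.

Lemma op_norm_ub (T : bounded_op) (x : X) : `|T x| <= op_norm T * `|x|.
Proof.
have [->|x0] := eqVneq x 0; first by rewrite linear0 !normr0 mulr0.
have nx : 0 < `|x| by rewrite normr_gt0.
have : `|T (`|x|^-1 *: x)| <= op_norm T.
  apply: (sup_upper_bound (op_norm_has_sup T)); exists (`|x|^-1 *: x) => //.
  by rewrite /unit_ball/= normrZ gtr0_norm ?invr_gt0// mulVf ?gt_eqF.
rewrite linearZ/= normrZ gtr0_norm ?invr_gt0//.
by rewrite ler_pdivrMl// mulrC.
Qed.

Lemma op_norm_le (T : bounded_op) (M : R) :
  (forall x, `|x| <= 1 -> `|T x| <= M) -> op_norm T <= M.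
Proof.
move=> TM; apply: ge_sup; first by case: (op_norm_has_sup T).
by move=> _ [x x1 <-]; exact: TM.
Qed.

Lemma op_norm_ge0 (T : bounded_op) : 0 <= op_norm T.
Proof.
rewrite -(normr0 Y) -(linear0 T); apply: (sup_upper_bound (op_norm_has_sup T)).
by exists 0 => //; rewrite /unit_ball/= normr0.
Qed.

Lemma op_norm_ball (T : bounded_op) (x : X) : `|x| <= 1 -> `|T x| <= op_norm T.
Proof.
by move=> x1; rewrite (le_trans (op_norm_ub T x))// ler_piMr// op_norm_ge0.
Qed.

Lemma op_normD (T S : bounded_op) : op_norm (T + S) <= op_norm T + op_norm S.
Proof.
apply: op_norm_le => x x1; rewrite (le_trans (ler_normD (T x) (S x)))//.
by rewrite lerD// op_norm_ball.
Qed.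

Lemma op_normZ (a : R) (T : bounded_op) : op_norm (a *: T) = `|a| * op_norm T.
Proof.
have leZ b S : op_norm (b *: S) <= `|b| * op_norm S.
  apply: op_norm_le => x x1; rewrite [`|_|](normrZ b (S x)).
  by rewrite ler_wpM2l// op_norm_ball.
apply/eqP; rewrite eq_le leZ/=.
have [->|a0] := eqVneq a 0; first by rewrite normr0 mul0r op_norm_ge0.
have := leZ a^-1 (a *: T); rewrite scalerA mulVf// scale1r normfV.
by rewrite ler_pdivlMl ?normr_gt0.
Qed.

Lemma op_norm0_eq0 (T : bounded_op) : op_norm T = 0 -> T = 0.
Proof.
move=> T0; apply: bounded_opE => x; apply/eqP; rewrite -normr_le0.
by rewrite (le_trans (op_norm_ub T x))// T0 mul0r.
Qed.

HB.instance Definition _ :=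
  Lmodule_isNormed.Build R bounded_op op_normD op_normZ op_norm0_eq0.

Definition extreme_contraction (T : bounded_op) :=
  extreme_points (unit_ball bounded_op) T.

Definition norm_attainment_set (T : bounded_op) : set X :=
  [set x | unit_sphere X x /\ `|T x| = `|T|].

End bounded_operators.

(* Main.v *)
(** If T is an extreme contraction but M_T and E_X do not span X together, take
    a nonzero functional phi vanishing on their intersection, y <> 0 and
    S = phi(.) y. At each of the finitely many extreme points x of B_X, either
    S x = 0 or |T x| < 1, so for small e > 0 the operators T - e S and T + e S
    are contractive at the extreme points of B_X. A continuous convex function
    on B_X is largest at an extreme point, so both are contractions with
    midpoint T, a contradiction. Conversely, if T = (1 - t) A + t B, then strict
    convexity forces A x = B x = T x whenever |T x| = 1, hence on the span. *)

From HB Require Import structures.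
Require Import Defs.
From mathcomp Require Import all_boot all_order all_algebra.
From mathcomp Require Import all_classical all_reals all_analysis.
From mathcomp Require Import ring lra.
Import Order.TTheory GRing.Theory Num.Theory.
Import numFieldNormedType.Exports.
Import VectorInternalTheory.
Local Open Scope classical_set_scope.
Local Open Scope ring_scope.

Set Implicit Arguments.
Unset Strict Implicit.

(** Row vectors carry the sup norm, so in the expansion of [v] along the standard basis each
    coefficient is at most [|v|]; the sum of the norms of the basis images is then a bound. *)
Lemma rV_linear_bounded (R : realType) n (W : normedModType R)
    (f : {linear 'rV[R]_n -> W}) : exists M : R, forall v, `|f v| <= M * `|v|.
Proof.
exists (\sum_i `|f (delta_mx 0 i)|) => v.
rewrite [in f v](row_sum_delta v) linear_sum (le_trans (ler_norm_sum _ _ _))//.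
rewrite mulr_suml; apply: ler_sum => i _.
rewrite linearZ/= normrZ mulrC ler_wpM2l//.
rewrite [leRHS]/Num.norm/= mx_normrE; apply/bigmax_geP; right.
by exists (0, i).
Qed.

Lemma linear_le_continuous (R : realType) (V W : normedModType R)
    (f : {linear V -> W}) (M : R) :
  (forall x, `|f x| <= M * `|x|) -> continuous f.
Proof.
move=> fM; apply/bounded_linear_continuous/linear_boundedP.
near=> r => x; rewrite (le_trans (fM x))// ler_wpM2r//.
Unshelve. all: by end_near. Qed.

Lemma rV_linear_continuous (R : realType) n (W : normedModType R)
  (f : {linear 'rV[R]_n -> W}) : continuous f.
Proof. by have [M /linear_le_continuous] := rV_linear_bounded f. Qed.

(** The hard half of the equivalence of norms: [|r2v v|] is continuous and nonzero on the compact
    sup-norm sphere, so it has a positive minimum there, whose inverse is the bound after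
    rescaling. *)
Lemma v2r_bounded (R : realType) (X : finDimBanachType R) :
  exists M : R, forall x : X, `|v2r x| <= M * `|x|.
Proof.
pose S := [set v : 'rV[R]_(dim X) | `|v| = 1].
have normS (x : X) : x != 0 -> S (`|v2r x|^-1 *: v2r x).
  move=> x0; have v0 : v2r x != 0 by rewrite -(inj_eq (@v2r_inj _ _)) linear0 in x0.
  by rewrite /S/= normrZ normfV normr_id mulVf// normr_eq0.
(* If [X] is zero, the sphere [S] is empty and no minimum exists. *)
have [X0|] := pselect (forall x : X, x = 0).
  by exists 0 => x; rewrite (X0 x) linear0 !normr0 mulr0.
move=> /existsNP[a /eqP a0].
have cS : compact S.
  apply: bounded_closed_compact.
    exists 1; split => // M M1 v /= ->; exact: ltW.
  apply: (@preimage_closed _ _ (Num.norm : 'rV[R]_(dim X) -> R) [set 1]).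
    by move=> v _; exact: norm_continuous.
  exact: closed_eq.
have cr : continuous (fun v : 'rV[R]_(dim X) => `|r2v v : X|).
  move=> v; apply: continuous_comp; last exact: norm_continuous.
  exact: rV_linear_continuous.
have [|c + cmin] := EVT_min_rV _ cS (continuous_subspaceT cr).
  by exists (`|v2r a|^-1 *: v2r a); exact: normS.
rewrite inE => Sc.
have c0 : 0 < `|r2v c : X|.
  rewrite normr_gt0 -(inj_eq (@v2r_inj _ _)) linear0 r2vK -normr_eq0.
  by rewrite [`|c|]Sc oner_eq0.
exists (`|r2v c : X|^-1) => x.
have [->|x0] := eqVneq x 0; first by rewrite linear0 !normr0 mulr0.
have := cmin _ (mem_set (normS _ x0)).
rewrite linearZ/= v2rK normrZ normfV normr_id.
have v0 : 0 < `|v2r x| by rewrite normr_gt0 -(linear0 v2r) (inj_eq (@v2r_inj _ _)).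
by rewrite !ler_pdivlMl// mulrC.
Qed.

Lemma v2r_continuous (R : realType) (X : finDimBanachType R) :
  continuous (v2r : X -> 'rV[R]_(dim X)).
Proof. by have [M /linear_le_continuous] := v2r_bounded X. Qed.

(** Factor [f] as [(f \o r2v) \o v2r], both factors being bounded. This turns the rank-one map of
    the main proof into a [bounded_op]. *)
Lemma linear_bounded_op (R : realType) (X : finDimBanachType R)
    (Y : normedModType R) (f : X -> Y) :
  linear f -> f \in @bounded_op_pred R X Y.
Proof.
move=> lf; apply/asboolP; split=> //.
pose F : {linear X -> Y} := HB.pack f (GRing.isLinear.Build R X Y *:%R f lf).
have [N fN] := rV_linear_bounded (F \o r2v).
have [M vM] := v2r_bounded X.
exists (`|N| * M) => x; rewrite -[x in f x]v2rK (le_trans (fN (v2r x)))//.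
rewrite -mulrA (@le_trans _ _ (`|N| * `|v2r x|))//.
  by rewrite ler_wpM2r// ler_norm.
by rewrite ler_wpM2l.
Qed.

(** In coordinates the ball is closed, and bounded by [v2r_bounded]; compactness is carried back by
    the continuous map [r2v]. *)
Lemma unit_ball_compact (R : realType) (X : finDimBanachType R) :
  compact (unit_ball X).
Proof.
pose B := [set v : 'rV[R]_(dim X) | `|r2v v : X| <= 1].
have cr : continuous (r2v : 'rV[R]_(dim X) -> X) by exact: rV_linear_continuous.
have cB : compact B.
  have [M vM] := v2r_bounded X; apply: bounded_closed_compact.
    exists `|M|; split=> // N MN v /= v1; rewrite -[v]r2vK.
    rewrite (le_trans (vM _))// (le_trans _ (ltW MN))//.
    by rewrite (le_trans (ler_wpM2r _ (ler_norm M)))// ler_piMr.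
  apply: (@preimage_closed 'rV[R]_(dim X) R (fun v => `|r2v v : X|) [set x | x <= 1]).
    move=> v _; apply: continuous_comp; [exact: cr|exact: norm_continuous].
  exact: closed_le.
suff -> : unit_ball X = r2v @` B.
  by apply: continuous_compact => //; exact: continuous_subspaceT.
apply/seteqP; split=> [x x1|_ [v v1 <-]//].
by exists (v2r x); rewrite /B/= v2rK.
Qed.

Lemma compact_convex_max_extreme (R : realType) (X : finDimBanachType R)
    (K : set X) (g : X -> R) :
  K !=set0 -> compact K -> continuous g ->
  (forall x y t, K x -> K y -> 0 < t < 1 ->
    g ((1 - t) *: x + t *: y) <= (1 - t) * g x + t * g y) ->
  exists2 e, extreme_points K e & forall x, K x -> g x <= g e.
Proof.
move=> K0 cK cg gconv.
have [c + cmax] := compact_EVT_max K0 cK (continuous_subspaceT cg).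
rewrite inE => Kc.
have gK x : K x -> g x <= g c by move=> Kx; apply: cmax; rewrite inE.
(* The maximisers of g in K are closed under taking endpoints of segments of K;
   maximising the strictly convex q among them singles out an extreme point. *)
pose q (x : X) := \sum_i (v2r x 0 i) ^+ 2.
(* Strict convexity of [q] as an exact identity, whose defect term is itself a value of [q]. *)
have qcvx x y t : q ((1 - t) *: x + t *: y) =
    (1 - t) * q x + t * q y - t * (1 - t) * q (x - y).
  rewrite /q !mulr_sumr -big_split/= -sumrB; apply: eq_bigr => i _.
  have -> : v2r ((1 - t) *: x + t *: y) 0 i =
    (1 - t) * v2r x 0 i + t * v2r y 0 i by rewrite linearD !linearZ/= !mxE.
  have -> : v2r (x - y) 0 i = v2r x 0 i - v2r y 0 i by rewrite linearB !mxE.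
  by ring.
have cq : continuous q.
  apply: continuous_big => [|i _ x]; first exact: add_continuous.
  have ci : {for x, continuous (fun x : X => v2r x 0 i)}.
    apply: (@continuous_comp X 'rV[R]_(dim X) R v2r (fun v => v 0 i)).
      exact: v2r_continuous.
    exact: coord_continuous.
  exact: (@continuousM R X _ _ x ci ci).
pose M := K `&` [set x | g x = g c].
have cM : compact M.
  apply: compact_closedI => //.
  apply: (@preimage_closed X R g [set g c]) => [x _|]; first exact: cg.
  exact: closed_eq.
have [|e + emax] := compact_EVT_max _ cM (continuous_subspaceT cq).
  by exists c.
rewrite inE => -[Ke ge]; exists e; last by move=> x /gK; rewrite ge.
split=> // x y t Kx Ky t01 exy.
have /andP[t0 t1] := t01.
have := gconv _ _ _ Kx Ky t01; rewrite -exy ge => gxy.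
(* A weighted mean, with positive weights, of two values at most [g c] reaches [g c] only if both
   equal it. *)
have gx : g x = g c.
  by apply/eqP; rewrite eq_le gK//=; have := gK _ Ky; nra.
have gy : g y = g c.
  by apply/eqP; rewrite eq_le gK//=; have := gK _ Kx; nra.
have qx : q x <= q e by apply: emax; rewrite inE.
have qy : q y <= q e by apply: emax; rewrite inE.
(* Both endpoints lie in [M], so their mean [q]-value is at most [q e], and the defect in [qcvx]
   cannot be positive. *)
have qxy0 : q (x - y) <= 0.
  have := qcvx x y t; rewrite -exy => qe.
  have tt : 0 < t * (1 - t) by rewrite mulr_gt0// subr_gt0.
  by rewrite -(pmulr_rle0 _ tt); nra.
have xy : x = y.
  apply/eqP; rewrite -subr_eq0 -(inj_eq (@v2r_inj _ _)) linear0.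
  apply/eqP/rowP => i; rewrite [RHS]mxE; apply/eqP; rewrite -sqrf_eq0.
  have q0 : q (x - y) = 0.
    by apply/eqP; rewrite eq_le qxy0 sumr_ge0// => j _; exact: sqr_ge0.
  by rewrite (psumr_eq0P _ q0)// => j _; exact: sqr_ge0.
by rewrite exy xy -scalerDl subrK scale1r.
Qed.

(** The residual [x - projv U x] is zero on [U] and nonzero at [v]; [phi] is one of its coordinates
    that does not vanish at [v]. *)
Lemma functional_vanishing (F : fieldType) (V : vectType F) (U : {vspace V})
    (v : V) : v \notin U ->
  exists phi : {linear V -> F^o}, (forall u, u \in U -> phi u = 0) /\ phi v != 0.
Proof.
move=> vU.
have : v2r (v - projv U v) != 0.
  rewrite -(linear0 v2r) (inj_eq (@v2r_inj _ _)) subr_eq0.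
  by apply: contra vU => /eqP ->; exact: memv_proj.
move=> /rV0Pn[i vi].
pose phi (x : V) : F^o := v2r (x - projv U x) 0 i.
have lphi : linear phi.
  move=> a x y; rewrite /phi (linearP (projv U)) opprD addrACA -scalerBr.
  by rewrite (linearP v2r) !mxE.
pose L : {linear V -> F^o} :=
  HB.pack phi (GRing.isLinear.Build F V F^o *:%R phi lphi).
exists L; split=> // u uU; rewrite /L/= /phi.
by rewrite projv_id// subrr linear0 mxE.
Qed.

Lemma uniform_small_step (R : realFieldType) (I : eqType) (s : seq I)
    (a b : I -> R) :
  (forall i, i \in s -> a i < 1) -> (forall i, 0 <= b i) ->
  exists2 e, 0 < e & forall i, i \in s -> a i + e * b i <= 1.
Proof.
move=> + b0; elim: s => [_|i s IH a1]; first by exists 1.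
have [j js|e e0 eP] := IH; first by apply: a1; rewrite in_cons js orbT.
have ai : a i < 1 by rewrite a1// mem_head.
have bi : 0 < b i + 1 by have := b0 i; lra.
(* Adding 1 to [b i] keeps the denominator positive when [b i] is zero. *)
exists (Num.min e ((1 - a i) / (b i + 1))).
  by rewrite lt_min e0 divr_gt0// subr_gt0.
move=> j; rewrite in_cons => /predU1P[->|/eP]; last first.
  by apply: le_trans; rewrite lerD2l ler_wpM2r// ge_min lexx.
rewrite -lerBrDl (@le_trans _ _ ((1 - a i) / (b i + 1) * b i))//.
  by rewrite ler_wpM2r// ge_min lexx orbT.
rewrite -mulrA ler_piMr ?subr_ge0 ?(ltW ai)// [_^-1 * _]mulrC ler_pdivrMr// mul1r.
by rewrite lerDl.
Qed.

Theorem theorem2p3 (R : realType) (X : finDimBanachType R) (Y : normedModType R)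
    (hX : polygonal X) (hY : strictly_convex Y)
    (T : bounded_op X Y) (hT : `|T| = 1) :
  extreme_contraction T <->
  set_span (norm_attainment_set T `&` extreme_points (unit_ball X)) = [set: X].
Proof.
have opN (S : bounded_op X Y) x : `|S x| <= `|S| * `|x| by exact: op_norm_ub.
have /finite_seqP[s sE] := hX.
split=> [[T1 Textr]|span]; last first.
  split=> [|A B t A1 B1 t01 TAB]; first by rewrite /unit_ball/= hT.
  have ext x : (norm_attainment_set T `&` extreme_points (unit_ball X)) x ->
      A x = T x /\ B x = T x.
    move=> [[x1 Tx] _].
    have [_] := hY (T x) (etrans Tx hT).
    apply; last 2 first; [exact: t01|by rewrite [in LHS]TAB|..].
      by rewrite /unit_ball/= (le_trans (opN A x))// x1 mulr1.
    by rewrite /unit_ball/= (le_trans (opN B x))// x1 mulr1.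
  suff ext' x : A x = T x /\ B x = T x.
    by split; apply: bounded_opE => x; case: (ext' x).
  have : [set: X] x by [].
  rewrite -span => -[r rM /(@coord_span _ _ _ (in_tuple r)) ->].
  rewrite !linear_sum.
  split; apply: eq_bigr => i _; rewrite !linearZ/=; congr (_ *: _).
    by have /rM/ext[] : r`_i \in r by exact: mem_nth.
  by have /rM/ext[] : r`_i \in r by exact: mem_nth.
pose s' := [seq x <- s | `|T x| == 1].
apply/seteqP; split=> // v _; exists s' => [x /=|].
  rewrite mem_filter => /andP[/eqP Tx xs].
  have xE : extreme_points (unit_ball X) x by rewrite sE.
  split=> //; split; last by rewrite Tx hT.
  (* Extremality gives [|x| <= 1]; the reverse follows from [1 = |T x| <= |x|]. *)
  apply/eqP; rewrite eq_le (proj1 xE)/= -Tx.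
  by rewrite (le_trans (opN T x))// hT mul1r.
apply/negP => /negP /functional_vanishing[phi [phi0 phiv]].
have [y y0] : exists y : Y, y != 0.
  apply/not_existsP => Y0; have : T = 0.
    apply: bounded_opE => x; rewrite [RHS]/=.
    by apply/eqP; apply: contra_notT (Y0 (T x)).
  by move=> T0; move: hT; rewrite T0 normr0 => /esym/eqP; rewrite oner_eq0.
have lS : linear (fun x => (phi x : R) *: y).
  by move=> a u w; rewrite linearP scalerDl scalerA.
pose S : bounded_op X Y := BoundedOp (linear_bounded_op lS).
(* Only extreme points with [|T x| < 1] constrain [e]; at the others [S] vanishes, since [phi] kills
   the span of [s']. *)
have [||e e0 eP] := @uniform_small_step R _ [seq x <- s | `|T x| != 1]
    (fun x => `|T x|) (fun x => `|S x|).
- move=> x; rewrite mem_filter => /andP[Tx xs]; rewrite lt_neqAle Tx/=.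
  have xE : extreme_points (unit_ball X) x by rewrite sE.
  by rewrite (le_trans (opN T x))// hT mul1r (proj1 xE).
- by move=> x; exact: normr_ge0.
(* Stated for any [c] of modulus [e] so as to cover both signs at once. *)
have Sball c : `|c| = e -> unit_ball (bounded_op X Y) (T + c *: S).
  move=> ce; apply: op_norm_le => x x1.
  pose g z := `|(T + c *: S) z|.
  have cg : continuous g.
    move=> z; apply: continuous_comp; last exact: norm_continuous.
    exact: (linear_le_continuous (opN _)).
  have [||z zE gz] := compact_convex_max_extreme _ (@unit_ball_compact R X) cg.
  - by exists 0; rewrite /unit_ball/= normr0.
  - move=> a b t _ _ /andP[t0 t1]; rewrite /g linearD !linearZ.
    rewrite (le_trans (ler_normD _ _))// !normrZ (gtr0_norm t0).
    by rewrite gtr0_norm ?subr_gt0.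
  rewrite (le_trans (gz x x1))// /g.
  rewrite (le_trans (ler_normD (T z) _))//.
  rewrite [X in _ + X](normrZ c (S z)) ce.
  have zs : z \in s by have := zE; rewrite sE.
  have [Tz|Tz] := eqVneq `|T z| 1; last by apply: eP; rewrite mem_filter Tz.
  have -> : S z = 0; last by rewrite normr0 mulr0 addr0 Tz.
  rewrite /S/= phi0 ?scale0r// memv_span// mem_filter Tz eqxx//.
have Te : T = (1 - 2^-1) *: (T + (- e) *: S) + 2^-1 *: (T + e *: S).
  rewrite scaleNr; have -> : 1 - 2^-1 = 2^-1 :> R by lra.
  rewrite -scalerDr addrACA addNr addr0 -mulr2n -[T *+ 2]scaler_nat scalerA mulVf//.
  by rewrite scale1r.
have ne : `|e| = e by rewrite gtr0_norm.
have nNe : `|- e| = e by rewrite normrN.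
have half : 0 < (2^-1 : R) < 1 by lra.
(* Extremality forces [e *: S = 0], but at [v] its value is [y] scaled by the nonzero numbers [e]
   and [phi v]. *)
have [_] := Textr _ _ _ (Sball _ nNe) (Sball _ ne) half Te.
move=> /eqP; rewrite -subr_eq0 addrAC subrr add0r => /eqP eS0.
have : (e *: S) v = 0 by rewrite eS0.
rewrite [LHS]/= => /eqP; rewrite !scaler_eq0 (gt_eqF e0) (negPf phiv).
by rewrite (negPf y0).
Qed.
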